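(* Let $v=(v_1,v_2)\in\mathbb{R}_{>0}^2$ and let $M$ be an interval module over $\mathbf{R}^2=\mathbb{R}_{\ge0}^2$ with minimal homogeneous generators $\{\mathfrak{g}_i\}_{i\in I}$ of degrees $\deg(\mathfrak{g}_i)=(a_i,b_i)$. Then the clustering algorithm described in the context computes $\dim_v(M)$ (i.e. its output $\ell$ equals $\dim_v(M)$) in at most $$\left\lceil\frac{b_{i_1}-\inf\{b_i\mid i\in I\}}{v_2}\right\rceil$$ iterations of Step 1, where $i_1$ is the first index selected by the algorithm.
   Context: Let $\mathbb{K}$ be a field and $\mathbf{R}^2=\mathbb{R}_{\ge 0}^2$ with the componentwise partial order. A persistence module is a functor from the poset $\mathbf{R}^2$ to $\mathbb{K}$-vector spaces, equivalently an $\mathbf{R}^2$-graded module over the monoid ring $\mathbb{K}[\mathbf{R}^2]$ of the monoid $(\mathbb{R}_{\ge 0}^2,+)$. For $v\in\mathbf{R}^2$, $v\ast m$ denotes the product of $m\in M$ with the monoid element $v$; for homogeneous $m$ it is regarded as having degree $\deg(v\ast m)=\deg(m)+v$. Also $v\ast M=\{v\ast m\mid m\in M\}$. A subset of $\mathbf{R}^2$ is an interval if (a) $g\le f\le h$ with $g,h$ in the subset implies $f$ in the subset, and (b) any two elements $g,h$ of it are connected by a zigzag $g\le g_1\ge g_2\le\cdots\ge g_{2m}\le h$ inside the subset. An interval module is a persistence module with value $\mathbb{K}$ on an interval, value $0$ elsewhere, and identity maps between the copies of $\mathbb{K}$. Shift-dimension: all elements of graded modules are taken homogeneous. Elements $m_1,\dots,m_k\in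 M$ $v$-generate $M$ if $v\ast(M/\langle m_1,\dots,m_k\rangle)=0$. A $v$-basis is a set of $v$-generators of smallest possible cardinality $k$, and $\dim_v(M):=k$ is the shift-dimension. Setting of the algorithm: $\mathfrak{G}=\{\mathfrak{g}_i\}_{i\in I}$, $I\subseteq\mathbb{R}_{\ge0}$, is the generating curve of $M$, i.e. the (possibly infinite) minimal set of homogeneous generators, with $\deg(\mathfrak{g}_i)=(a_i,b_i)$, indexed such that $a_i<a_j$ or $b_i>b_j$ whenever $i<j$. Algorithm. Step 1: Set $I_1:=I$, $k:=1$. While there exists $i\in I_k$ such that $v\ast\mathfrak{g}_i\ne0$, do: (a) set $i_k$ to be the maximum of the set $\{i\in I_k\mid\deg(\mathfrak{g}_i)\le\deg(v\ast\mathfrak{g}_j)\text{ for all }j\in I_k\text{ such that }j<i\text{ and }v\ast\mathfrak{g}_j\ne0\}$ (these maxima are taken to exist); (b) define $I_{k+1}:=I_k\setminus\{i\in I_k\mid\deg(\mathfrak{g}_{i_k})\le\deg(v\ast\mathfrak{g}_i)\}$; (c) replace $k$ by $k+1$ and iterate. Step 2: Set $\mathfrak{H}:=\{\mathfrak{g}_{i_1},\dots,\mathfrak{g}_{i_\ell}\}$ (all indices selected in Step 1) and $\ell:=|\mathfrak{H}|$. Step 3: Return $\ell$ and $\mathfrak{H}$. The index $i_1$ in the bound is defined when at least one iteration of Step 1 is performed.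
   Formalization: The iteration bound is proved as max(1, ⌈(b_{i_1} − inf b_i)/v_2⌉): when b_{i_1} = inf b_i (e.g. M free on one generator at (0,0), v=(1,1)) the printed bound is 0 although one iteration is performed. *)

(* Defs.v *)
From HB Require Import structures.
From mathcomp Require Import all_boot all_order all_algebra.
From mathcomp Require Import all_classical all_reals.
From mathcomp Require Import interval_inference generic_quotient ring_quotient.

Set Implicit Arguments.
Unset Strict Implicit.
Unset Printing Implicit Defensive.

Import Order.TTheory GRing.Theory Num.Theory.
Local Open Scope classical_set_scope.
Local Open Scope card_scope.
Local Open Scope ring_scope.
Local Open Scope quotient_scope.

Section Degrees.
Variable R : realType.

Definition degree := ({nonneg R}%R * {nonneg R}%R)%type.

Definition degle (x y : degree) : bool :=
  (x.1%:num <= y.1%:num) && (x.2%:num <= y.2%:num).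

Definition degadd (x y : degree) : degree :=
  ((x.1%:num + y.1%:num)%:nng, (x.2%:num + y.2%:num)%:nng).

Lemma degle_addr x v : degle x (degadd x v).
Proof. by rewrite /degle /= !lerDl !ge0. Qed.

(* Both conditions hold vacuously for the empty set, which gives M = 0. *)
Definition is_interval2 (D : set degree) : Prop :=
  (forall x y z, D x -> D z -> degle x y -> degle y z -> D y) /\
  (forall x y, D x -> D y -> exists (m : nat) (z : nat -> degree),
     [/\ z 0%N = x, z m.*2.+1 = y,
         forall k, (k <= m.*2.+1)%N -> D (z k),
         forall k, (k <= m)%N -> degle (z k.*2) (z k.*2.+1) &
         forall k, (k < m)%N -> degle (z k.*2.+2) (z k.*2.+1)]).

End Degrees.

Section PersistenceModules.
Variables (R : realType) (K : fieldType).

Record persmod := Persmod {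
  space :> degree R -> lmodType K;
  trans : forall x y : degree R, degle x y -> {linear space x -> space y};
  trans_id : forall x (h : degle x x) (u : space x), trans h u = u;
  trans_comp : forall x y z (xy : degle x y) (yz : degle y z) (xz : degle x z)
    (u : space x), trans yz (trans xy u) = trans xz u
}.

Definition homog (M : persmod) := {x : degree R & M x}.

Definition hdeg (M : persmod) (m : homog M) : degree R := projT1 m.

(* The zero vector of each degree is a homogeneous element of that degree. *)
Definition hzero (M : persmod) (m : homog M) : Prop := projT2 m = 0.

Definition shift (M : persmod) (v : degree R) (m : homog M) : homog M :=
  existT (fun x => M x) (degadd (hdeg m) v)
         (trans M (degle_addr (hdeg m) v) (projT2 m)).

Definition interval_module (M : persmod) : Prop :=
  exists D : set (degree R),
    [/\ is_interval2 D,
        forall x, ~ D x -> forall u : M x, u = 0 &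
        exists phi : forall x, {linear M x -> K^o},
          (forall x, D x -> bijective (phi x)) /\
          (forall x y (xy : degle x y), D x -> D y ->
             forall u : M x, phi y (trans M xy u) = phi x u)].

Record submodule (M : persmod) := Submodule {
  subm_at :> forall x, submodClosed (M x);
  subm_trans : forall x y (xy : degle x y) (u : M x),
    u \in subm_at x -> trans M xy u \in subm_at y
}.

Definition contains (M : persmod) (N : submodule M) (S : set (homog M)) : Prop :=
  forall m, S m -> projT2 m \in N (hdeg m).

Definition gen_at (M : persmod) (S : set (homog M)) (x : degree R) :
    {pred M x} :=
  fun u => `[< forall N : submodule M, contains N S -> u \in N x >].

Arguments gen_at {M} S x _.

Lemma gen_at_submod (M : persmod) (S : set (homog M)) x :
  subsemimod_closed (gen_at S x).
Proof.
split; first split.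
- by apply/asboolP => N _; exact: rpred0.
- move=> u w /asboolP Su /asboolP Sw; apply/asboolP => N NS.
  by apply: rpredD; [exact: Su | exact: Sw].
- move=> a u /asboolP Su; apply/asboolP => N NS.
  by apply: rpredZ; exact: Su.
Qed.

HB.instance Definition _ (M : persmod) (S : set (homog M)) x :=
  GRing.isSubSemiModClosed.Build K (M x) (gen_at S x) (gen_at_submod S x).

Lemma gen_at_trans (M : persmod) (S : set (homog M)) x y (xy : degle x y)
  (u : M x) : u \in gen_at S x -> trans M xy u \in gen_at S y.
Proof.
by move=> /asboolP Su; apply/asboolP => N NS; apply: subm_trans; exact: Su.
Qed.

Definition generated (M : persmod) (S : set (homog M)) : submodule M :=
  @Submodule M (fun x => gen_at S x : submodClosed (M x))
    (fun x y xy u => @gen_at_trans M S x y xy u).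

Definition generates (M : persmod) (S : set (homog M)) : Prop :=
  forall x (u : M x), u \in generated S x.

Definition minimal_generators (M : persmod) (S : set (homog M)) : Prop :=
  generates S /\ forall T, T `<=` S -> generates T -> T = S.

End PersistenceModules.

Section QuotientSpace.
Variables (K : fieldType) (V : lmodType K) (N : submodClosed V).

(* A copy of N carrying the zmodClosed instance required by Quotient.quot. *)
Definition zpred : {pred V} := fun u => u \in N.

Lemma zpred_zmod : zmod_closed zpred.
Proof. exact: GRing.submod_closedB (submodClosedP N). Qed.

HB.instance Definition _ := GRing.isZmodClosed.Build V zpred zpred_zmod.

Definition qspace := Quotient.quot zpred.
HB.instance Definition _ := GRing.Zmodule.on qspace.

Definition qpi (u : V) : qspace := \pi_(Quotient.quot zpred) u.
Definition qrepr (q : qspace) : V := repr (q : Quotient.quot zpred).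

Lemma qreprK q : qpi (qrepr q) = q.
Proof. exact: reprK. Qed.

Lemma qpi_eq (u w : V) : qpi u = qpi w <-> u - w \in N.
Proof.
split=> [/eqP|uw]; first by rewrite -Quotient.idealrBE.
by apply/eqP; rewrite -Quotient.idealrBE.
Qed.

Lemma qpiD u w : qpi (u + w) = qpi u + qpi w.
Proof. by rewrite /qpi raddfD. Qed.

Lemma qpi0 : qpi 0 = 0.
Proof. by apply: (addrI (qpi 0)); rewrite -qpiD !addr0. Qed.

Definition qscale (a : K) (q : qspace) : qspace := qpi (a *: qrepr q).

Lemma qpiZ a u : qpi (a *: u) = qscale a (qpi u).
Proof.
by apply/qpi_eq; rewrite -scalerBr rpredZ //; apply/qpi_eq; rewrite qreprK.
Qed.

Fact qscaleA a b q : qscale a (qscale b q) = qscale (a * b) q.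
Proof. by rewrite -[q]qreprK -!qpiZ scalerA. Qed.

Fact qscale1 : left_id 1 qscale.
Proof. by move=> q; rewrite -[q]qreprK -qpiZ scale1r. Qed.

Fact qscaleDr : right_distributive qscale +%R.
Proof.
by move=> a p q; rewrite -[p]qreprK -[q]qreprK -qpiD -!qpiZ -qpiD scalerDr.
Qed.

Fact qscaleDl q : {morph qscale^~ q : a b / a + b}.
Proof. by move=> a b; rewrite -[q]qreprK -!qpiZ -qpiD scalerDl. Qed.

HB.instance Definition _ := GRing.Zmodule_isLmodule.Build K qspace
  qscaleA qscale1 qscaleDr qscaleDl.

End QuotientSpace.

Section QuotientMap.
Variables (K : fieldType) (V W : lmodType K).
Variables (N : submodClosed V) (P : submodClosed W) (f : {linear V -> W}).
Hypothesis fNP : forall u, u \in N -> f u \in P.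

Definition qmap (q : qspace N) : qspace P := qpi P (f (qrepr q)).

Lemma qmapE u : qmap (qpi N u) = qpi P (f u).
Proof.
by apply/qpi_eq; rewrite -linearB fNP //; apply/qpi_eq; rewrite qreprK.
Qed.

Fact qmap_linear : linear qmap.
Proof.
move=> a p q; rewrite -[p]qreprK -[q]qreprK -[a *: _]qpiZ -qpiD !qmapE.
by rewrite linearP qpiD qpiZ.
Qed.

Definition qlin : {linear qspace N -> qspace P} :=
  HB.pack_for {linear qspace N -> qspace P} qmap
    (GRing.isLinear.Build K (qspace N) (qspace P) *:%R qmap qmap_linear).

End QuotientMap.

Section ShiftDimension.
Variables (R : realType) (K : fieldType).

Section QuotientModule.
Variables (M : persmod R K) (N : submodule M).

Definition quot_trans x y (xy : degle x y) :
    {linear qspace (N x) -> qspace (N y)} :=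
  qlin (@subm_trans _ _ _ N x y xy).

Fact quot_trans_id x (h : degle x x) (q : qspace (N x)) : quot_trans h q = q.
Proof. by rewrite -[q]qreprK [LHS]qmapE ?trans_id //; exact: subm_trans. Qed.

Fact quot_trans_comp x y z (xy : degle x y) (yz : degle y z) (xz : degle x z)
  (q : qspace (N x)) : quot_trans yz (quot_trans xy q) = quot_trans xz q.
Proof.
rewrite -[q]qreprK /quot_trans /= !qmapE ?(trans_comp xy yz xz) //;
  exact: subm_trans.
Qed.

Definition quotient : persmod R K :=
  @Persmod R K (fun x => qspace (N x)) quot_trans quot_trans_id quot_trans_comp.

End QuotientModule.

Definition shift_kills (v : degree R) (M : persmod R K) : Prop :=
  forall m : homog M, hzero (shift v m).

Definition vgenerates (v : degree R) (M : persmod R K) (S : set (homog M)) :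
    Prop :=
  finite_set S /\ shift_kills v (quotient (generated S)).

Lemma shift_kills_quotient v (M : persmod R K) (N : submodule M) :
  shift_kills v (quotient N) <->
  forall m : homog M, projT2 (shift v m) \in N (hdeg (shift v m)).
Proof.
have q0 x (u : M x) : (qpi (N x) u = 0 :> qspace (N x)) <-> u \in N x.
  by rewrite -(qpi0 (N x)) qpi_eq subr0.
split=> H.
- move=> [x u]; apply/q0; move: (H (existT _ x (qpi (N x) u))).
  by rewrite /hzero /shift /= qmapE //; exact: subm_trans.
- move=> [x q]; rewrite /hzero /shift /= -[q]qreprK qmapE; last exact: subm_trans.
  by apply/q0; exact: (H (existT _ x (qrepr q))).
Qed.

Definition vbasis (v : degree R) (M : persmod R K) (S : set (homog M)) : Prop :=
  vgenerates v S /\ forall T : set (homog M), vgenerates v T -> S #<= T.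

(* "dim_v(M) = k": relational, since M may have no finite set of v-generators. *)
Definition shift_dim (v : degree R) (M : persmod R K) (k : nat) : Prop :=
  exists S : set (homog M), vbasis v S /\ S #= `I_k.

End ShiftDimension.

Section Algorithm.
Variables (R : realType) (K : fieldType) (M : persmod R K).

(* g is only meaningful on the index set I. *)
Definition generating_curve (I : set R) (g : R -> homog M) : Prop :=
  [/\ forall i, I i -> 0 <= i,
      minimal_generators (g @` I) &
      forall i j, I i -> I j -> i < j ->
        (hdeg (g i)).1%:num < (hdeg (g j)).1%:num \/
        (hdeg (g j)).2%:num < (hdeg (g i)).2%:num].

Variables (v : degree R) (g : R -> homog M).

Definition active (J : set R) : Prop := exists i, J i /\ ~ hzero (shift v (g i)).

Definition candidates (J : set R) : set R :=
  [set i | J i /\ forall j, J j -> j < i -> ~ hzero (shift v (g j)) ->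
             degle (hdeg (g i)) (hdeg (shift v (g j)))].

Definition is_maximum (A : set R) (i : R) : Prop :=
  A i /\ forall j, A j -> j <= i.

Definition remaining (J : set R) (i : R) : set R :=
  J `\` [set j | J j /\ degle (hdeg (g i)) (hdeg (shift v (g j)))].

(* alg_state I s J: after (size s) iterations of the while loop the selected
   indices are s = [:: i_1; ...; i_k] and I_{k+1} = J. *)
Inductive alg_state (I : set R) : seq R -> set R -> Prop :=
| AlgInit : alg_state I [::] I
| AlgStep s J i : alg_state I s J -> active J -> is_maximum (candidates J) i ->
    alg_state I (rcons s i) (remaining J i).

(* The algorithm halts after (size s) iterations of Step 1 and returns l = |H|,
   where H is the set of the generators selected. *)
Definition alg_returns (I : set R) (s : seq R) (l : nat) (H : set (homog M)) :
    Prop :=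
  [/\ exists2 J, alg_state I s J & ~ active J,
      H = [set g i | i in [set` s]] &
      H #= `I_l].

End Algorithm.

(* Main.v *)
From HB Require Import structures.
Require Import Defs.
From mathcomp Require Import all_boot all_order all_algebra.
From mathcomp Require Import all_classical all_reals.
From mathcomp Require Import interval_inference.

Set Implicit Arguments.
Unset Strict Implicit.
Unset Printing Implicit Defensive.

Import Order.TTheory GRing.Theory Num.Theory.
Local Open Scope classical_set_scope.
Local Open Scope card_scope.
Local Open Scope ring_scope.

(** In an interval module every graded piece is at most one-dimensional and
    every transition map between nonzero pieces is injective ([thin]). So the
    submodule generated by [S] is all or nothing in each degree: it fills degree
    [x] as soon as a nonzero element of [S] sits below [x]. Two combinatorial
    facts follow.
    - The minimal generators form an antichain, so along the curve the first
      coordinate increases and the second decreases ([curve_staircase]).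
    - A finite set [v]-generates the module if and only if each generator [g j] with
      [v * g j <> 0] has a nonzero element of the set below degree
      [deg (g j) + v]. Since such an element lies above some generator, the
      shift-dimension is the least size of a finite set of indices that covers
      all active [j], where [i] covers [j] when [deg (g i) <= deg (g j) + v]
      ([covering_vgenerates], [vgenerates_covering]).

    Along a staircase the indices covering a given [j] form an interval around
    [j], whose endpoints are monotone in [j]; the algorithm is the greedy
    stabbing of these intervals from left to right. It selects an increasing
    sequence of indices. It is optimal because a finite covering [T] must have an
    element in every half-open gap between consecutive selections
    ([covering_between]): otherwise the first element of [T] beyond the previous
    selections would be a candidate larger than the maximal one.

    A selected index remained uncovered by the earlier selections, all to its
    left, so its second coordinate lies below each of theirs by more than [v.2]
    ([next_drop]). The second coordinates being nonnegative, the algorithm halts,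
    and adding up the drops bounds the number of iterations. *)

(** * Preliminaries *)

Lemma card_set_uniq (T : eqType) (s : seq T) : uniq s ->
  [set` s] #= `I_(size s).
Proof.
elim: s => [_|x s IH /andP[xs us]].
  by rewrite set_nil II0.
apply/eq_cardSP; exists x; first by rewrite /= mem_head.
rewrite (_ : _ `\ x = [set` s]); first exact: IH.
apply/seteqP; split=> y /=; first by rewrite inE => -[/predU1P[]].
move=> ys; split; first by rewrite inE ys orbT.
by move=> yx; rewrite -yx ys in xs.
Qed.

Lemma seq_minimum disp (X : orderType disp) (T : seq X) t : t \in T ->
  exists2 m, m \in T & forall k, k \in T -> (m <= k)%O.
Proof.
elim: T t => // x T IH t _.
have [T0|[y yT]] : T = [::] \/ exists y, y \in T.
  by case: T {IH} => [|y T]; [left|right; exists y; rewrite mem_head].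
  by exists x; rewrite ?mem_head // T0 => k; rewrite inE => /eqP ->.
have [m mT mmin] := IH _ yT.
have [xm|mx] := leP x m.
  exists x; first exact: mem_head.
  by move=> k; rewrite inE => /predU1P[->//|/mmin]; exact: le_trans.
exists m; first by rewrite inE mT orbT.
by move=> k; rewrite inE => /predU1P[->|/mmin//]; exact: ltW.
Qed.

Lemma degle_trans (R : realType) : transitive (@degle R).
Proof.
move=> y x z /andP[x1 x2] /andP[y1 y2]; apply/andP; split.
  exact: le_trans y1.
exact: le_trans y2.
Qed.

Lemma degle_add2r (R : realType) (v x y : degree R) :
  degle (degadd x v) (degadd y v) = degle x y.
Proof. by rewrite /degle /= !lerD2r. Qed.

(** * Submodules generated by homogeneous elements *)

Section Reachability.
Variables (R : realType) (K : fieldType) (M : persmod R K).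
Implicit Types (S : set (homog M)) (x y z : degree R).

Definition reached S x : Prop :=
  exists m, [/\ S m, ~ hzero m & degle (hdeg m) x].

Lemma reached_le S x y : degle x y -> reached S x -> reached S y.
Proof.
by move=> xy [m [Sm m0 mx]]; exists m; split=> //; exact: degle_trans xy.
Qed.

Section ReachedSubmodule.
Variable S : set (homog M).

Definition reached_at x : {pred M x} := fun u => `[< u = 0 \/ reached S x >].

Lemma reached_at_closed x : subsemimod_closed (@reached_at x).
Proof.
split; first split.
- by apply/asboolP; left.
- move=> u w /asboolP[->|Sx]; last by move=> _; apply/asboolP; right.
  by move=> /asboolP[->|Sx]; apply/asboolP; [left; rewrite addr0 | right].
- move=> a u /asboolP[->|Sx]; last by apply/asboolP; right.
  by apply/asboolP; left; rewrite scaler0.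
Qed.

HB.instance Definition _ x :=
  GRing.isSubSemiModClosed.Build K (M x) (@reached_at x) (@reached_at_closed x).

Lemma reached_at_trans x y (xy : degle x y) (u : M x) :
  u \in @reached_at x -> trans M xy u \in @reached_at y.
Proof.
move=> /asboolP[->|Sx]; apply/asboolP; first by left; rewrite linear0.
by right; exact: reached_le Sx.
Qed.

Definition reached_submodule : submodule M :=
  @Submodule R K M (fun x => @reached_at x : submodClosed (M x)) reached_at_trans.

(** The degrees reached by [S] form an up-set, so taking the whole space there
    and zero elsewhere is a submodule; it contains [S], hence it bounds the
    generated submodule. *)
Lemma generated_reached x (u : M x) :
  u \in generated S x -> u = 0 \/ reached S x.
Proof.
move=> /asboolP /(_ reached_submodule) Su; apply/asboolP; apply: Su => -[y w] Sw.
apply/asboolP; have [w0|w0] := pselect (w = 0); first by left.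
by right; exists (existT _ y w); split=> //; rewrite /degle !lexx.
Qed.

End ReachedSubmodule.
End Reachability.

(** * Thin modules *)

Section Thin.
Variables (R : realType) (K : fieldType) (M : persmod R K).

(** The only features of an interval module that matter below; unlike the
    interval itself, they are stated without choosing coordinates. *)
Definition thin : Prop :=
  (forall x (u w : M x), u <> 0 -> exists c : K, w = c *: u) /\
  (forall x y (xy : degle x y) (u : M x) (w : M y),
      u <> 0 -> w <> 0 -> trans M xy u <> 0).

Lemma interval_module_thin : interval_module M -> thin.
Proof.
move=> [D [_ D0 [phi [phi_bij phi_trans]]]].
have DP x (u : M x) : u <> 0 -> D x.
  by move=> u0; apply: contrapT => Dx; exact: u0 (D0 _ Dx u).
have phi_inj x (u : M x) : D x -> phi x u = 0 -> u = 0.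
  move=> /phi_bij /bij_inj phi_inj pu; apply: phi_inj.
  by rewrite pu linear0.
split=> [x u w u0|x y xy u w u0 w0 tu0].
- have Dx := DP _ _ u0.
  have pu0 : phi x u != 0 by apply/eqP => /(phi_inj _ _ Dx).
  exists (phi x w / phi x u); apply: (bij_inj (phi_bij _ Dx)).
  by rewrite linearZ /= /GRing.scale /= divfK.
- have Dx := DP _ _ u0; have Dy := DP _ _ w0.
  by apply: u0; apply: phi_inj => //; rewrite -(phi_trans x y xy) // tu0 linear0.
Qed.

Hypothesis M_thin : thin.
Implicit Types S : set (homog M).

(** The converse of [generated_reached]: by injectivity a nonzero element below
    degree [x] has nonzero image there, and that image spans the line [M x]. *)
Lemma reached_generated S x (u : M x) : reached S x -> u \in generated S x.
Proof.
have [lineM injM] := M_thin.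
move=> [[y w] [Sw w0 yx]].
have [->|u0] := pselect (u = 0); first exact: rpred0.
have [c ->] := lineM x _ u (injM _ _ yx _ _ w0 u0).
by rewrite rpredZ // subm_trans //; apply/asboolP => N; apply.
Qed.

Lemma generatesP S :
  generates S <-> forall x (u : M x), u <> 0 -> reached S x.
Proof.
split=> [Sgen x u u0|Sr x u]; first by have [] := generated_reached (Sgen x u).
have [->|u0] := pselect (u = 0); first exact: rpred0.
by apply: reached_generated; exact: Sr u0.
Qed.

Lemma minimal_generators_nonzero S m :
  minimal_generators S -> S m -> ~ hzero m.
Proof.
move=> [/generatesP Sgen Smin] Sm m0.
suff SE : S `\ m = S by move: Sm; rewrite -SE => -[_]; apply.
apply: Smin; first exact: subDsetl.
apply/generatesP => x u /Sgen [n [Sn n0 nx]]; exists n; split=> //; split=> //.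
by move=> nm; apply: n0; rewrite nm.
Qed.

(** A generator above another one is a multiple of its image, so it could be
    dropped. *)
Lemma minimal_generators_antichain S m n :
  minimal_generators S -> S m -> S n -> degle (hdeg m) (hdeg n) -> m = n.
Proof.
move=> Smg Sm Sn mn; apply: contrapT => mDn.
have [/generatesP Sgen Smin] := Smg.
suff SE : S `\ n = S by move: Sn; rewrite -SE => -[_]; apply.
apply: Smin; first exact: subDsetl.
apply/generatesP => x u /Sgen [p [Sp p0 px]].
have [pn|pDn] := pselect (p = n); last by exists p.
exists m; split=> //; first exact: minimal_generators_nonzero Smg Sm.
by apply: degle_trans px; rewrite pn.
Qed.

(** It suffices to test [v]-generation on generators: a [u] surviving the shift
    lies above some [w] in [G], and the transition from [w] to the shift of [u]
    is nonzero and factors through the shift of [w], which is thus nonzero too. *)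
Lemma vgeneratesP (G S : set (homog M)) v : generates G ->
  vgenerates v S <-> finite_set S /\
    forall m, G m -> ~ hzero (shift v m) -> reached S (degadd (hdeg m) v).
Proof.
move=> /generatesP Ggen; split=> -[Sfin].
  move=> /shift_kills_quotient Sv; split=> // m _ mv.
  by have [] := generated_reached (Sv m).
move=> Sr; split=> //; apply/shift_kills_quotient => -[x u].
have [->|uv] := pselect (projT2 (shift v (existT _ x u)) = 0).
  exact: rpred0.
have [u0|u0] := pselect (u = 0).
  by case: uv; rewrite /shift /= u0 linear0.
have [[y w] [Gw w0 /= yx]] := Ggen _ _ u0.
apply: reached_generated; apply: (@reached_le _ _ _ _ (degadd y v)).
  by rewrite /= degle_add2r.
apply: (Sr _ Gw) => wv.
have yxv : degle y (degadd x v) := degle_trans yx (degle_addr x v).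
have yvxv : degle (degadd y v) (degadd x v) by rewrite degle_add2r.
apply: (M_thin.2 _ _ yxv w _ w0 uv).
rewrite -(trans_comp (degle_addr y v) yvxv yxv w).
by move: wv; rewrite /hzero /= => ->; rewrite linear0.
Qed.

End Thin.

(** * The greedy run on a staircase of degrees *)

Section GreedyRun.
Variables (R : realType) (K : fieldType) (M : persmod R K) (v : degree R).
Variables (I : set R) (g : R -> homog M).
Local Notation a i := ((hdeg (g i)).1%:num).
Local Notation b i := ((hdeg (g i)).2%:num).
Implicit Types (s : seq R) (J : set R) (i j k t : R).

Definition covers i j : bool := degle (hdeg (g i)) (degadd (hdeg (g j)) v).

Definition staircase : Prop :=
  forall i j, I i -> I j -> i < j -> a i < a j /\ b j < b i.

Hypothesis stair : staircase.

Lemma covers_refl i : covers i i.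
Proof. exact: degle_addr. Qed.

Lemma covers_left i j : I i -> I j -> i <= j ->
  covers i j = (b i <= b j + v.2%:num).
Proof.
move=> Ii Ij; rewrite le_eqVlt => /predU1P[->|ij].
  by rewrite covers_refl lerDl ge0.
rewrite /covers /degle /=; have [aij _] := stair Ii Ij ij.
by rewrite (le_trans (ltW aij)) // lerDl ge0.
Qed.

Lemma covers_right i j : I i -> I j -> j <= i ->
  covers i j = (a i <= a j + v.1%:num).
Proof.
move=> Ii Ij; rewrite le_eqVlt => /predU1P[->|ji].
  by rewrite covers_refl lerDl ge0.
rewrite /covers /degle /=; have [_ bij] := stair Ij Ii ji.
by rewrite (le_trans (ltW bij)) ?andbT // lerDl ge0.
Qed.

(** The next three lemmas make the relation [covers] interval-like: a covering
    index may be moved closer to the covered one, from either side, and a covered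
    index may be moved closer to an index covering it from the left. *)
Lemma covers_closer_left i t j : I i -> I t -> I j ->
  t <= i -> i <= j -> covers t j -> covers i j.
Proof.
move=> Ii It Ij ti ij; rewrite !covers_left ?(le_trans ti ij) //.
apply: le_trans; move: ti; rewrite le_eqVlt => /predU1P[->//|ti].
exact: ltW (stair It Ii ti).2.
Qed.

Lemma covers_closer_right i t j : I i -> I t -> I j ->
  j <= i -> i <= t -> covers t j -> covers i j.
Proof.
move=> Ii It Ij ji it; rewrite !covers_right ?(le_trans ji it) //.
apply: le_trans; move: it; rewrite le_eqVlt => /predU1P[->//|it].
exact: ltW (stair Ii It it).1.
Qed.

Lemma covers_left_mono i t j : I i -> I t -> I j ->
  i <= t -> t <= j -> covers i j -> covers i t.
Proof.
move=> Ii It Ij it tj; rewrite !covers_left ?(le_trans it tj) // => /le_trans.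
apply; rewrite lerD2r; move: tj; rewrite le_eqVlt => /predU1P[->//|tj].
exact: ltW (stair It Ij tj).2.
Qed.

Definition is_active j : Prop := ~ hzero (shift v (g j)).

(** The successive removals collapse into one condition, because whether [j]
    gets removed depends on the selected indices alone. *)
Lemma alg_stateE s J : alg_state v g I s J ->
  J = [set j | I j /\ forall i, i \in s -> ~ covers i j].
Proof.
elim=> [|{}s {}J i _ -> _ _]; apply/seteqP; split=> j.
- by move=> Ij; split.
- by case.
- move=> [[Ij js] ij]; split=> // k; rewrite mem_rcons inE.
  by case/predU1P=> [->|/js//] kj; apply: ij; split.
- move=> [Ij js]; split.
    by split=> // k ks; apply: js; rewrite mem_rcons inE ks orbT.
  by move=> [_]; apply: js; rewrite mem_rcons mem_head.
Qed.

Lemma alg_state_sub s J : alg_state v g I s J -> J `<=` I.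
Proof. by move=> /alg_stateE -> j []. Qed.

Lemma alg_state_index s J i : alg_state v g I s J -> i \in s -> I i.
Proof.
elim=> // {}s {}J k /alg_state_sub JI IH _ [[/JI Ik _] _].
by rewrite mem_rcons inE => /predU1P[->|].
Qed.

(** A maximum is a candidate, so it covers every active remaining index to its
    left; these are removed at once. *)
Lemma selected_lt_active s J i j : alg_state v g I s J ->
  i \in s -> J j -> is_active j -> i < j.
Proof.
elim=> // {}s {}J k st IH _ [[Jk cand] _].
rewrite mem_rcons inE => /predU1P[->|/IH{}IH] [Jj kj] jact; last exact: IH.
rewrite ltNge; apply/negP; rewrite le_eqVlt => /predU1P[jk|jk].
  by apply: kj; split=> //; rewrite -jk; exact: covers_refl.
by apply: kj; split=> //; exact: cand.
Qed.

Hypothesis v1_gt0 : 0 < v.1%:num.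

(** There need not be a leftmost active index. An active index whose first
    coordinate is within [v.1] of the infimum over the active ones does instead:
    it covers all active indices to its left. *)
Lemma active_candidate J : J `<=` I -> active v g J ->
  exists j, is_active j /\ candidates v g J j.
Proof.
move=> JI [i0 [Ji0 act0]].
pose A := [set a j | j in [set j | J j /\ is_active j]].
have A_inf : has_inf A.
  split; first by exists (a i0), i0.
  by exists 0 => _ [j _ <-]; exact: ge0.
have [_ [j [Jj jact] <-] jinf] := inf_adherent v1_gt0 A_inf.
exists j; split=> //; split=> // k Jk kj kact.
have -> : degle (hdeg (g j)) (hdeg (shift v (g k))) = covers j k by [].
rewrite covers_right; [|exact: JI|exact: JI|exact: ltW].
apply: le_trans (ltW jinf) _; rewrite lerD2r.
by apply: ge_inf; [exact: A_inf.2 | exists k].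
Qed.

Lemma selected_lt_next s J i k : alg_state v g I s J -> active v g J ->
  is_maximum (candidates v g J) i -> k \in s -> k < i.
Proof.
move=> st Jact [_ imax] ks.
have [j [jact jcand]] := active_candidate (alg_state_sub st) Jact.
by apply: lt_le_trans (imax _ jcand); exact: selected_lt_active st ks jcand.1 jact.
Qed.

(** The index [k] lies to the left of [i] and does not cover it, which along the
    staircase can only fail in the second coordinate. *)
Lemma next_drop s J i k : alg_state v g I s J -> active v g J ->
  is_maximum (candidates v g J) i -> k \in s -> b i + v.2%:num < b k.
Proof.
move=> st Jact imax ks.
have ki := selected_lt_next st Jact imax ks.
have [[Ji _] _] := imax; have Ii := alg_state_sub st Ji.
have Ik := alg_state_index st ks.
move: Ji; rewrite (alg_stateE st) => -[_ /(_ _ ks)].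
by rewrite (covers_left Ik Ii (ltW ki)) ltNge => /negP.
Qed.

Lemma alg_state_uniq s J : alg_state v g I s J -> uniq s.
Proof.
elim=> // {}s {}J i st IH Jact imax; rewrite rcons_uniq IH andbT.
by apply/negP => /(selected_lt_next st Jact imax); rewrite ltxx.
Qed.

Definition covering (T : seq R) : Prop :=
  {in T, forall t, I t} /\
  forall j, I j -> is_active j -> exists2 t, t \in T & covers t j.

(** The step of the optimality argument. Active remaining indices can only be
    covered by elements [T'] of [T] to the right of all selections, since any
    other element would let some selection cover them. If the least [t]
    in [T'] exceeded [i], it would be a candidate: an active [j < t] is covered
    by some [t' >= t], hence by [t]. *)
Lemma covering_between (T : seq R) s J i : covering T ->
  alg_state v g I s J -> active v g J -> is_maximum (candidates v g J) i ->
  exists t, [/\ t \in T, t <= i & forall k, k \in s -> k < t].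
Proof.
move=> [TI Tcov] st Jact imax.
have JI := alg_state_sub st.
pose T' := [seq t <- T | all (fun k => k < t) s].
have T'cov j : J j -> is_active j -> exists2 t, t \in T' & covers t j.
  move=> Jj jact; have [t tT tj] := Tcov j (JI _ Jj) jact.
  exists t => //; rewrite mem_filter tT andbT; apply/allP => k ks.
  have kj := selected_lt_active st ks Jj jact.
  have Ik := alg_state_index st ks; have It := TI _ tT; have Ij := JI _ Jj.
  rewrite ltNge; apply/negP => tk.
  move: Jj; rewrite (alg_stateE st) => -[_ /(_ _ ks)]; apply.
  exact: covers_closer_left (ltW kj) tj.
have [j0 [Jj0 j0act]] := Jact.
have [t0 t0T' _] := T'cov _ Jj0 j0act.
have [t tT' tmin] := seq_minimum t0T'.
have [/allP slt tT] : all (fun k => k < t) s /\ t \in T.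
  by apply/andP; move: tT'; rewrite mem_filter.
exists t; split=> //; rewrite leNgt; apply/negP => it.
have It := TI _ tT; have [[Ji icand] imax'] := imax; have Ii := JI _ Ji.
suff tcand : candidates v g J t by have := imax' _ tcand; rewrite leNgt it.
split=> [|j Jj jt jact].
  rewrite (alg_stateE st); split=> // k ks kt.
  move: Ji; rewrite (alg_stateE st) => -[_ /(_ _ ks)]; apply.
  have ki := selected_lt_next st Jact imax ks.
  exact: covers_left_mono (alg_state_index st ks) Ii It (ltW ki) (ltW it) kt.
have [t' t'T' t'j] := T'cov _ Jj jact.
have It' : I t' by apply: TI; move: t'T'; rewrite mem_filter => /andP[].
exact: covers_closer_right It It' (JI _ Jj) (ltW jt) (tmin _ t'T') t'j.
Qed.

(** Each iteration contributes a new element of the covering, so no covering is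
    smaller than the set of selected indices. *)
Lemma covering_distinct (T : seq R) s J : covering T -> alg_state v g I s J ->
  exists ts, [/\ uniq ts, {subset ts <= T} & size ts = size s].
Proof.
move=> Tcov st.
(* The bound by selected indices makes the next element found a new one. *)
suff [ts [uts tsT szts _]] : exists ts, [/\ uniq ts, {subset ts <= T},
    size ts = size s & forall t, t \in ts -> exists2 k, k \in s & t <= k].
  by exists ts.
elim: st => [|{}s {}J i st [ts [uts tsT szts tss]] Jact imax].
  by exists [::].
have [t [tT ti slt]] := covering_between Tcov st Jact imax.
exists (t :: ts); split=> /=; last 1 first.
- move=> u; rewrite inE => /predU1P[->|/tss [k ks uk]].
    by exists i; rewrite ?mem_rcons ?mem_head.
  by exists k; rewrite // mem_rcons inE ks orbT.
- rewrite uts andbT; apply/negP => /tss[k /slt kt].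
  by rewrite leNgt kt.
- by move=> u; rewrite inE => /predU1P[->|/tsT].
- by rewrite szts size_rcons.
Qed.

Lemma halted_covering s J : alg_state v g I s J -> ~ active v g J -> covering s.
Proof.
move=> st Jdone; split=> [i|j Ij jact]; first exact: alg_state_index st.
apply: contrapT => snc; apply: Jdone; exists j; split=> //.
rewrite (alg_stateE st); split=> // i si ij; apply: snc; by exists i.
Qed.

Hypothesis v2_gt0 : 0 < v.2%:num.
Hypothesis maxima_exist : forall s J, alg_state v g I s J -> active v g J ->
  exists i, is_maximum (candidates v g J) i.

(** As the second coordinate of the last selection drops by more than [v.2] at
    each iteration and stays nonnegative, it bounds the number of remaining
    iterations. *)
Lemma run_halts : exists s J, alg_state v g I s J /\ ~ active v g J.
Proof.
have halts n : forall s J i, alg_state v g I s J -> i \in s ->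
    b i < n%:R * v.2%:num -> exists s J, alg_state v g I s J /\ ~ active v g J.
  elim: n => [|n IH] s J i st si bi.
    by move: bi; rewrite mul0r ltNge ge0.
  have [Jact|] := pselect (active v g J); last by exists s, J.
  have [k kmax] := maxima_exist st Jact.
  apply: (IH _ _ k (AlgStep st Jact kmax)); first by rewrite mem_rcons mem_head.
  rewrite -(ltrD2r v.2%:num) (lt_trans (next_drop st Jact kmax si)) //.
  by rewrite -natr1 mulrDl mul1r in bi.
have [Iact|] := pselect (active v g I); last by exists [::], I; split=> //; constructor.
have [i imax] := maxima_exist (AlgInit v g I) Iact.
apply: (halts (Num.bound (b i / v.2%:num)) _ _ i
  (AlgStep (AlgInit v g I) Iact imax)); first by rewrite mem_head.
by rewrite -ltr_pdivrMr // archi_boundP // divr_ge0 ?ge0.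
Qed.

Lemma run_drop s J i s' : alg_state v g I s J -> s = i :: s' -> s' <> [::] ->
  exists2 k, k \in s & (size s')%:R * v.2%:num < b i - b k.
Proof.
move=> st; elim: st i s' => // {}s {}J k st IH Jact kmax i s'.
case: s st IH => [|i0 s0] st IH; rewrite ?rcons_cons => -[<- <-] // _.
exists k; first by rewrite inE mem_rcons mem_head orbT.
have [->|s00] := eqVneq s0 [::].
  by rewrite /= mul1r ltrBrDl (next_drop st Jact kmax) // mem_head.
have [j js jdrop] := IH _ _ erefl (elimNTF eqP s00).
rewrite size_rcons -natr1 mulrDl mul1r.
have := next_drop st Jact kmax js; rewrite -ltrBrDl => kj.
by have := ltrD jdrop kj; rewrite addrA subrK.
Qed.

End GreedyRun.

(** * From generating sets to coverings *)

Section Cover.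
Variables (R : realType) (K : fieldType) (M : persmod R K) (v : degree R).
Variables (I : set R) (g : R -> homog M).
Hypothesis M_thin : thin M.
Hypothesis g_curve : generating_curve I g.

Lemma curve_nonzero i : I i -> ~ hzero (g i).
Proof.
have [_ gmin _] := g_curve => Ii.
by apply: (minimal_generators_nonzero M_thin gmin); exists i.
Qed.

Lemma curve_staircase : staircase I g.
Proof.
have [_ gmin g_lt] := g_curve.
have anti i j : I i -> I j -> degle (hdeg (g i)) (hdeg (g j)) -> g i = g j.
  by move=> Ii Ij; apply: (minimal_generators_antichain M_thin gmin); [exists i|exists j].
move=> i j Ii Ij ij; split; rewrite ltNge; apply/negP => le.
  have [] := g_lt _ _ Ii Ij ij; first by rewrite ltNge le.
  move=> blt; move: (blt); rewrite (anti j i) ?ltxx //.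
  by rewrite /degle le ltW.
have [] := g_lt _ _ Ii Ij ij; last by rewrite ltNge le.
move=> alt; move: (alt); rewrite (anti i j) ?ltxx //.
by rewrite /degle le ltW.
Qed.

Lemma curve_inj : {in I &, injective g}.
Proof.
move=> i j /set_mem Ii /set_mem Ij gij; case: (ltgtP i j) => // ij.
  by have [] := curve_staircase Ii Ij ij; rewrite gij ltxx.
by have [] := curve_staircase Ij Ii ij; rewrite gij ltxx.
Qed.

Lemma covering_vgenerates (T : seq R) : covering v I g T ->
  vgenerates v [set g i | i in [set` T]].
Proof.
have [_ [gen _] _] := g_curve.
move=> [TI Tcov]; apply/(vgeneratesP M_thin _ _ gen); split.
  exact/finite_image/finite_seq.
move=> _ [j Ij <-] /(Tcov _ Ij) [t tT tj].
by exists (g t); split=> //; [exists t | exact: curve_nonzero (TI _ tT)].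
Qed.

(** Each nonzero element of [S] is replaced by a generator below it, which covers
    at least as much. *)
Lemma vgenerates_covering (S : set (homog M)) : vgenerates v S ->
  exists2 T : seq R, covering v I g T & [set` T] #<= S.
Proof.
have [_ [gen _] _] := g_curve.
move=> /(vgeneratesP M_thin _ _ gen) [Sfin Sr].
have /choice[f fP] (m : homog M) : exists i, ~ hzero m ->
    I i /\ degle (hdeg (g i)) (hdeg m).
  have [m0|m0] := pselect (hzero m); first by exists 0 => /(_ m0).
  have /(_ _ _ m0) := (generatesP M_thin _).1 gen.
  by move=> [_ [[i Ii <-] _ im]]; exists i.
pose S' := [set m | S m /\ ~ hzero m].
have S'fin : finite_set S' by apply: sub_finite_set Sfin => m [].
have [T TE] := (finite_seqP _).1 (finite_image f S'fin).
have TP t : t \in T -> exists2 m, S' m & f m = t.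
  by move=> tT; have : [set` T] t := tT; rewrite -TE.
exists T; last first.
  rewrite -TE; apply: card_le_trans (card_image_le _ _) _.
  by apply: subset_card_le => m [].
split=> [t /TP[m [_ /fP[Ifm _]] <-//]|j Ij jact].
have [|m [Sm m0 mj]] := Sr (g j) _ jact; first by exists j.
exists (f m); first by have : [set` T] (f m) by rewrite -TE; exists m.
exact: degle_trans (fP _ m0).2 mj.
Qed.

End Cover.

(* The maximum with 1 only matters when b_{i_1} = inf b: there the algorithm
   makes exactly one iteration, whereas the ceiling is 0. *)
Theorem theorem3p25 (R : realType) (K : fieldType) (v : degree R)
  (M : persmod R K) (I : set R) (g : R -> homog M)
  (v1_gt0 : 0 < v.1%:num) (v2_gt0 : 0 < v.2%:num)
  (M_interval : interval_module M)
  (g_curve : generating_curve I g)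
  (maxima_exist : forall (s : seq R) (J : set R),
     alg_state v g I s J -> active v g J ->
     exists i, is_maximum (candidates v g J) i) :
  exists (s : seq R) (l : nat) (H : set (homog M)),
    [/\ alg_returns v g I s l H,
        shift_dim v M l &
        forall i1 s', s = i1 :: s' ->
          (size s)%:Z <=
            Num.max 1 (Num.ceil (((hdeg (g i1)).2%:num
                - inf [set (hdeg (g i)).2%:num | i in I]) / v.2%:num))].
Proof.
have M_thin := interval_module_thin M_interval.
have stair := curve_staircase M_thin g_curve.
have [s [J [st Jdone]]] := run_halts stair v1_gt0 v2_gt0 maxima_exist.
pose H := [set g i | i in [set` s]].
have s_card := card_set_uniq (alg_state_uniq stair v1_gt0 st).
have sI i : i \in s -> I i by exact: alg_state_index st.
have H_card : H #= `I_(size s).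
  apply: card_eq_trans s_card; apply: inj_card_eq => i j.
  move=> /set_mem /sI Ii /set_mem /sI Ij.
  by apply: (curve_inj M_thin g_curve); exact/mem_set.
exists s, (size s), H; split; first by split=> //; exists J.
- exists H; split=> //; split.
    exact: covering_vgenerates (halted_covering st Jdone).
  move=> S /(vgenerates_covering M_thin g_curve) [T Tcov TS].
  have [ts [uts tsT szts]] := covering_distinct stair v1_gt0 Tcov st.
  rewrite (card_le_eql H_card) -szts -(card_le_eql (card_set_uniq uts)).
  by apply: card_le_trans TS; apply: subset_card_le => t; exact: tsT.
- move=> i s' sE; rewrite le_max.
  (* A single iteration is covered by the 1 in the maximum; from two on, the
     drop is strict, so the ceiling gains the missing unit. *)
  have [s'0|s'0] := eqVneq s' [::]; first by rewrite sE s'0.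
  apply/orP; right; rewrite sE /= intS lez1D.
  rewrite ceil_gt_int ltr_pdivlMr //.
  have [k ks kdrop] := run_drop stair v1_gt0 st sE (elimNTF eqP s'0).
  apply: lt_le_trans kdrop _; rewrite lerD2l lerN2.
  apply: ge_inf; first by exists 0 => _ [j _ <-]; exact: ge0.
  by exists k => //; exact: sI.
Qed.
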